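(* Let $X$ satisfy $dX_t=a_t\,dt+\sigma_t\,dW_t+dJ_t$, $t\in\,]0,T]$, $X_0=x_0\in\mathbb{R}$, where $J_t=\sum_{j=1}^{N_t}\gamma_j$ is a finite activity jump process, $N$ is a non-explosive counting process, and the random variables $\gamma_j$ satisfy: for all $t\in[0,T]$, $P\{\Delta N_t\neq 0,\ \gamma_{N_t}=0\}=0$. Let $t_i=ih$, $i=0,\dots,n$, with $nh=T$. Suppose also that 1) a.s. $\displaystyle\limsup_{h\to 0}\frac{\sup_{i}\left|\int_{t_{i-1}}^{t_i}a_s\,ds\right|}{\sqrt{h\log\frac1h}}\le C(\omega)<\infty$; 2) a.s. $\int_0^T\sigma_s^2\,ds<\infty$ and $\displaystyle\limsup_{h\to 0}\frac{\sup_i\left|\int_{t_{i-1}}^{t_i}\sigma_s^2\,ds\right|}{h}\le M(\omega)<\infty$; 3) $r(h)$ is a deterministic function of the lag $h$ between the observations such that $\displaystyle\lim_{h\to0}r(h)=0$ and $\displaystyle\lim_{h\to 0}\frac{h\log\frac1h}{r(h)}=0$. Then for $P$-almost all $\omega$ there exists $\bar h(\omega)$ such that for all $h\le\bar h(\omega)$ we have $$\forall i=1,\dots,n,\qquad I_{\{\Delta_iN=0\}}(\omega)=I_{\{(\Delta_iX)^2\le r(h)\}}(\omega).$$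
   Context: $(\Omega,(\mathcal F_t)_{t\in[0,T]},\mathcal F,P)$ is a filtered probability space, with $T>0$ finite and fixed. $W$ is a standard Brownian motion; $a,\sigma$ are progressively measurable processes such that the equation for $X$ has a unique strong solution on $[0,T]$ which is adapted and right continuous with left limits. $X$ is observed at the times $t_i=ih$, $i=0,\dots,n$, with $T=nh$. A jump process has finite activity if a.s. it makes finitely many jumps in each finite time interval; the jump sizes $\gamma_j$ are not necessarily i.i.d., nor independent of $N$. For a process $Z$, $\Delta_iZ=Z_{t_i}-Z_{t_{i-1}}$ and $\Delta Z_t=Z_t-Z_{t-}$. $I_A$ is the indicator of $A$. $C$ and $M$ are finite random variables. The function $r(h)$ is used as a threshold for the squared increments of $X$.
   Formalization: The condition on the jump sizes is taken as: almost surely, for no t in [0,T] is ΔN_t≠0 and γ_{N_t}=0 (for each fixed t separately, Poisson N with γ=0 is a counterexample); and r(h)>0 is assumed for small h>0 (r(h)=-√h is a counterexample). *)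

(* Defs.v *)
From HB Require Import structures.
From mathcomp Require Import all_boot all_order all_algebra.
From mathcomp Require Import all_classical all_reals all_analysis.
Set Implicit Arguments.
Unset Strict Implicit.
Unset Printing Implicit Defensive.
Import Order.TTheory GRing.Theory Num.Theory.
Import numFieldNormedType.Exports.
Local Open Scope classical_set_scope.
Local Open Scope ring_scope.

(* A real process on [0, T] is a function [Z : R -> Omega -> R]; its values at
   times outside [0, T] are never used. *)

Section paths.
Context {R : realType}.
Implicit Types (T t : R) (f : R -> R).

Definition cadlag T f :=
  (forall t, 0 <= t < T -> f x @[x --> t^'+] --> f t) /\
  (forall t, 0 < t <= T -> cvg (f x @[x --> t^'-])).

(* f(t) - f(t-), with the convention f(0-) = f(0) *)
Definition jump f t : R :=
  if 0 < t then f t - lim (f x @[x --> t^'-]) else 0.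

End paths.

Section processes.
Context {d : measure_display} {Omega : measurableType d} {R : realType}.
Implicit Types (Z : R -> Omega -> R) (Ft : R -> set (set Omega)).

Definition obs_time (h : R) (i : nat) : R := i%:R * h.

Definition increment Z (h : R) (i : nat) (w : Omega) : R :=
  Z (obs_time h i) w - Z (obs_time h i.-1) w.

Definition filtration (T : R) Ft :=
  [/\ forall t, 0 <= t <= T -> sigma_algebra setT (Ft t),
      forall t, 0 <= t <= T -> Ft t `<=` measurable
    & forall s t, 0 <= s -> s <= t -> t <= T -> Ft s `<=` Ft t].

(* Since [Ft t] is a sigma-algebra, it is the set of measurable sets of
   [g_sigma_algebraType (Ft t)]. *)
Definition adapted (T : R) Ft Z :=
  forall t, 0 <= t <= T ->
    measurable_fun setT (Z t : g_sigma_algebraType (Ft t) -> R).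

Definition progressively_measurable (T : R) Ft Z :=
  forall t, 0 <= t <= T ->
    measurable_fun (`[0, t] `*` setT)
      (fun p : R * g_sigma_algebraType (Ft t) =>
         Z p.1 p.2).

(* H_t = sum_(k < m) xi_k 1_(]s_k, s_(k+1)])(t) with xi_k bounded and
   F_(s_k)-measurable *)
Record simple_process (T : R) Ft := SimpleProcess {
  sp_size : nat;
  sp_time : nat -> R;
  sp_coef : nat -> Omega -> R;
  sp_time_ge0 : 0 <= sp_time 0%N;
  sp_time_leT : sp_time sp_size <= T;
  sp_time_nd : forall k, (k < sp_size)%N -> sp_time k <= sp_time k.+1;
  sp_coef_meas : forall k, (k < sp_size)%N ->
    measurable_fun setT (sp_coef k :
      g_sigma_algebraType (Ft (sp_time k)) -> R);
  sp_coef_bnd : forall k, (k < sp_size)%N ->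
    exists c : R, forall w, `|sp_coef k w| <= c }.

Definition sp_fun (T : R) Ft (H : simple_process T Ft) : R -> Omega -> R :=
  fun t w => \sum_(k < sp_size H)
    sp_coef H k w * \1_(`]sp_time H k, sp_time H k.+1]) t.

Definition sp_integral (T : R) Ft (H : simple_process T Ft) Z :
    R -> Omega -> R :=
  fun t w => \sum_(k < sp_size H)
    sp_coef H k w *
    (Z (Num.min (sp_time H k.+1) t) w - Z (Num.min (sp_time H k) t) w).

Context (P : probability Omega R).

Definition indistinguishable (T : R) Z Z' :=
  {ae P, forall w, forall t, 0 <= t <= T -> Z t w = Z' t w}.

Definition brownian_motion (T : R) Ft (W : R -> Omega -> R) :=
  [/\ adapted T Ft W,
      {ae P, forall w, W 0 w = 0},
      {ae P, forall w, {within `[0, T], continuous (W ^~ w)}},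
      (forall s t, 0 <= s -> s < t -> t <= T ->
         forall B : set R, measurable B ->
           P [set w | B (W t w - W s w)] = normal_prob 0 (Num.sqrt (t - s)) B)
    & (forall s t, 0 <= s -> s < t -> t <= T ->
         forall (E : set Omega) (B : set R),
           Ft s E -> measurable B ->
           P (E `&` [set w | B (W t w - W s w)]) =
           (P E * P [set w | B (W t w - W s w)%R])%E)].

Definition cvg0_in_probability (U : nat -> Omega -> \bar R) :=
  forall e : R, 0 < e ->
    P [set w | (e%:E <= `|U n w|)%E] @[n --> \oo] --> (0 : \bar R).

(* [Y] is a version with a.s. continuous paths of the Ito integral
   t |-> int_0^t sigma_s dW_s, for sigma progressively measurable with
   int_0^T sigma_s^2 ds < oo a.s.: the limit in probability of the elementary
   integrals of simple processes H_n such that int_0^T (H_n - sigma)^2 ds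
   tends to 0 in probability.  This determines [Y] up to
   indistinguishability. *)
Definition ito_integral (T : R) Ft (W sigma Y : R -> Omega -> R) :=
  [/\ forall t, 0 <= t <= T ->
        measurable_fun setT (Y t),
      {ae P, forall w, {within `[0, T], continuous (Y ^~ w)}}
    & exists H : nat -> simple_process T Ft,
        cvg0_in_probability (fun n w =>
          (\int[lebesgue_measure]_(s in `[0%R, T])
             ((sp_fun (H n) s w - sigma s w) ^+ 2)%R%:E)%E) /\
        forall t, 0 <= t <= T ->
          cvg0_in_probability (fun n w =>
            (sp_integral (H n) W t w - Y t w)%:E)].

(* Values in [nat] make [N] non-explosive; the unit jumps are those of
   N_t = #{j | tau_j <= t} with strictly increasing jump times. *)
Definition counting_process (T : R) (N : R -> Omega -> nat) :=
  (forall t, 0 <= t <= T -> measurable_fun setT (N t)) /\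
  {ae P, forall w,
    [/\ N 0 w = 0%N,
        forall s t, 0 <= s -> s <= t -> t <= T -> (N s w <= N t w)%N,
        cadlag T (fun t => (N t w)%:R)
      & forall t, 0 <= t <= T ->
          jump (fun s => (N s w)%:R) t = 0 \/
          jump (fun s => (N s w)%:R) t = 1]}.

Definition jump_process (N : R -> Omega -> nat) (gamma : nat -> Omega -> R) :
    R -> Omega -> R :=
  fun t w => \sum_(1 <= j < (N t w).+1) gamma j w.

(* a.s., for no t in [0, T]: Delta N_t <> 0 and gamma_(N_t) = 0.
   The quantifier over t is inside the almost sure event: asking
   P(Delta N_t <> 0, gamma_(N_t) = 0) = 0 for each fixed t is void whenever
   the jump times of N have no atoms (e.g. N Poisson), even if gamma = 0. *)
Definition no_null_jump (T : R) (N : R -> Omega -> nat)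
    (gamma : nat -> Omega -> R) :=
  {ae P, forall w, forall t, 0 <= t <= T ->
    ~ (jump (fun s => (N s w)%:R : R) t <> 0 /\ gamma (N t w) w = 0)}.

(* dX_t = a_t dt + sigma_t dW_t + dJ_t on ]0, T], X_0 = x0 *)
Definition strong_solution (T : R) Ft (W a sigma J : R -> Omega -> R) (x0 : R)
    (X : R -> Omega -> R) :=
  [/\ adapted T Ft X,
      {ae P, forall w, cadlag T (X ^~ w)},
      {ae P, forall w,
        lebesgue_measure.-integrable `[0, T] (fun s => (a s w)%:E)}
    & exists2 Y, ito_integral T Ft W sigma Y &
        {ae P, forall w, forall t, 0 <= t <= T ->
          X t w = x0 + \int[lebesgue_measure]_(s in `[0, t]) a s w
                  + Y t w + J t w}].

Definition unique_strong_solution (T : R) Ft (W a sigma J : R -> Omega -> R)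
    (x0 : R) (X : R -> Omega -> R) :=
  strong_solution T Ft W a sigma J x0 X /\
  forall X', strong_solution T Ft W a sigma J x0 X' ->
    indistinguishable T X X'.

End processes.

(* sup_(1 <= i <= n) |int_(t_(i-1))^(t_i) f_s ds| with t_i = i h *)
Definition sup_abs_integral {R : realType} (f : R -> R) (h : R) (n : nat) : R :=
  \big[Num.max/0]_(1 <= i < n.+1)
    `|\int[lebesgue_measure]_(s in `[obs_time h i.-1, obs_time h i]) f s|.

(* Main.v *)
Require Import Defs.
From HB Require Import structures.
From mathcomp Require Import all_boot all_order all_algebra.
From mathcomp Require Import all_classical all_reals all_analysis.
From mathcomp Require Import measurable_realfun ring lra.
Import Order.TTheory GRing.Theory Num.Theory.
Import numFieldNormedType.Exports.
Local Open Scope classical_set_scope.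
Local Open Scope ring_scope.
Set Implicit Arguments.
Unset Strict Implicit.

(** For a simple process [H] and a Brownian motion [W], the exponential
    [exp (lam * int H dW - lam^2 / 2 * int H^2 ds)] has expectation 1 (condition
    on the past and integrate the Gaussian increment).  Markov's inequality and a
    passage to the limit in probability give, for the Ito integral [Y] of
    [sigma], [P (|Y_t - Y_s| >= x, int_s^t sigma^2 <= v) <= 2 exp (- x^2 / (32 v))].
    With [v = K h] and [x^2 = 96 K h log (1/h)] the bound is [2 h^3], so the [n]
    intervals of the grid [h = T / n] together contribute [O(1 / n^2)]; by
    Borel-Cantelli, almost surely all increments of [Y] over the grid are
    [O(sqrt (h log (1/h)))].  Hence so are the increments of [X - J], which are
    then eventually dominated by [sqrt (r h)].  Pathwise, finitely many jumps
    with nonzero sizes are eventually isolated by the grid, and their absolute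
    sizes are bounded below by a positive constant that exceeds
    [2 * sqrt (r h)]. *)

(** * Gaussian exponential moments *)

Section density.
Context d (T : measurableType d) (R : realType).
Variables (mu nu : {measure set T -> \bar R}) (g : T -> R).
Hypothesis mg : measurable_fun setT g.
Hypothesis g0 : forall x, 0 <= g x.
Hypothesis nuE : forall A, measurable A -> nu A = (\int[mu]_(x in A) (g x)%:E)%E.
Import HBNNSimple.

(** Both sides are monotone limits along nonnegative simple functions increasing to [f]; for a
    simple function the identity is [nuE] on each level set. *)
Lemma ge0_integral_density (f : T -> R) : measurable_fun setT f ->
  (forall x, 0 <= f x) ->
  (\int[nu]_x (f x)%:E = \int[mu]_x (f x * g x)%:E)%E.
Proof.
move=> mf f0.
have mf' : measurable_fun setT (fun x => (f x)%:E) by exact/measurable_EFinP.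
pose f_ := nnsfun_approx measurableT mf'.
have cvf x : EFin \o f_^~ x @ \oo --> (f x)%:E.
  by apply: cvg_nnsfun_approx => // *; rewrite lee_fin.
transitivity (limn (fun n => \int[nu]_x (f_ n x)%:E)%E).
  rewrite -monotone_convergence//.
  - by apply: eq_integral => x _; apply/esym/cvg_lim => //; exact: cvf.
  - by move=> n; exact/measurable_EFinP/measurable_funP.
  - by move=> n y _; rewrite lee_fin.
  - by move=> y _ m n mn; rewrite lee_fin; exact/lefP/nd_nnsfun_approx.
rewrite [X in limn X](_ : _ = (fun n => \int[mu]_x (f_ n x * g x)%:E)%E).
  rewrite -monotone_convergence//; last 3 first.
  - by move=> n; apply/measurable_EFinP/measurable_funM.
  - by move=> n y _; rewrite lee_fin mulr_ge0.
  - move=> y _ m n mn; rewrite lee_fin ler_wpM2r//.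
    exact/lefP/nd_nnsfun_approx.
  apply: eq_integral => x _; apply/cvg_lim => //.
  under eq_fun do rewrite EFinM.
  by rewrite EFinM; apply: cvgeZr => //; exact: cvf.
apply/funext => n.
transitivity (\sum_(k \in range (f_ n))
    \int[nu]_x (k * \1_(f_ n @^-1` [set k]) x)%:E)%E.
  under eq_integral do rewrite fimfunE -fsumEFin//.
  rewrite ge0_integral_fsum//.
  - by move=> y; exact/measurable_EFinP/measurable_funM.
  - by move=> y x _; rewrite nnfun_muleindic_ge0.
transitivity (\sum_(k \in range (f_ n))
    \int[mu]_x (k * \1_(f_ n @^-1` [set k]) x * g x)%:E)%E.
  apply: eq_fsbigr => k /[!inE] -[x _ fxk].
  have k0 : 0 <= k by rewrite -fxk.
  under eq_integral do rewrite EFinM.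
  under [RHS]eq_integral do rewrite -mulrA EFinM.
  rewrite !ge0_integralZl_EFin//; last 3 first.
  - by move=> y _; rewrite lee_fin mulr_ge0.
  - exact/measurable_EFinP/measurable_funM.
  - exact/measurable_EFinP.
  congr (_ * _)%E; rewrite integral_indic// setIT nuE//.
  rewrite integral_mkcond; apply: eq_integral => y _.
  by rewrite patchE indicE mulrC; case: ifP => _; rewrite ?mulr1 ?mulr0.
rewrite -ge0_integral_fsum//.
- apply: eq_integral => x _; rewrite fsumEFin//.
  by rewrite [in RHS]fimfunE mulr_fsuml.
- by move=> r; apply/measurable_EFinP; do !apply: measurable_funM.
- by move=> r x _; rewrite EFinM mule_ge0 ?nnfun_muleindic_ge0// lee_fin.
Qed.
End density.

Section normal_mgf.
Context (R : realType).

(** Completing the square: an exponential tilt of a centred Gaussian density moves its mean to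
    [a * s ^+ 2], up to a constant factor. *)
Lemma expR_normal_pdf (a s x : R) : s != 0 ->
  expR (a * x) * normal_pdf 0 s x =
  expR (a ^+ 2 * s ^+ 2 / 2) * normal_pdf (a * s ^+ 2) s x.
Proof.
move=> s0; rewrite !normal_pdfE//.
rewrite mulrCA [RHS]mulrCA; congr (_ * _); rewrite /normal_fun -!expRD.
congr expR; field; exact: s0.
Qed.

Lemma normal_mgf (a s : R) : s != 0 ->
  (\int[normal_prob 0 s]_x (expR (a * x))%:E = (expR (a ^+ 2 * s ^+ 2 / 2))%:E)%E.
Proof.
move=> s0.
rewrite (@ge0_integral_density _ _ _ lebesgue_measure _ (normal_pdf 0 s)) //.
- under eq_integral do rewrite expR_normal_pdf// EFinM.
  have mpdf := @measurable_normal_pdf R (a * s ^+ 2) s.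
  rewrite ge0_integralZl//; last 2 first.
  + by apply/measurable_EFinP; exact: mpdf.
  + by move=> x _; rewrite lee_fin normal_pdf_ge0.
  by rewrite integral_normal_pdf mule1.
- exact: measurable_normal_pdf.
- by move=> x; exact: normal_pdf_ge0.
- by apply: measurableT_comp => //; apply: measurable_funM.
Qed.
End normal_mgf.

Section sub_sigma_algebra.
Context d (Omega : measurableType d).
Variable G : set (set Omega).
Hypotheses (sG : sigma_algebra setT G) (Gm : G `<=` measurable).

Lemma sub_sigma_preimage d' (T' : measurableType d') (f : Omega -> T') B :
  measurable_fun setT (f : g_sigma_algebraType G -> T') ->
  measurable B -> G (f @^-1` B).
Proof.
move=> mf mB; have := mf measurableT B mB.
by rewrite setTI measurable_g_measurableTypeE.
Qed.

Lemma sub_sigma_measurable d' (T' : measurableType d') (f : Omega -> T') :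
  measurable_fun setT (f : g_sigma_algebraType G -> T') -> measurable_fun setT f.
Proof.
by move=> mf _ B mB; rewrite setTI; apply: Gm; exact: sub_sigma_preimage.
Qed.

Lemma sub_sigma_le (G' : set (set Omega)) d' (T' : measurableType d')
    (f : Omega -> T') : sigma_algebra setT G' -> G `<=` G' ->
  measurable_fun setT (f : g_sigma_algebraType G -> T') ->
  measurable_fun setT (f : g_sigma_algebraType G' -> T').
Proof.
move=> sG' GG' mf _ B mB; rewrite setTI measurable_g_measurableTypeE//.
by apply: GG'; exact: sub_sigma_preimage.
Qed.
End sub_sigma_algebra.

Section exponential_freezing.
Context d (Omega : measurableType d) (R : realType) (P : probability Omega R).
Variable G : set (set Omega).
Hypotheses (sG : sigma_algebra setT G) (Gm : G `<=` measurable).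

(* The joint law of [(U, xi)] and [D] is a product measure, so Tonelli lets one
   integrate [D] out with [(U, xi)] frozen. *)
Lemma integral_expR_indep_normal (U xi D : Omega -> R) (s : R) : s != 0 ->
  measurable_fun setT (U : g_sigma_algebraType G -> R) -> (forall w, 0 <= U w) ->
  measurable_fun setT (xi : g_sigma_algebraType G -> R) ->
  measurable_fun setT D ->
  (forall B, measurable B -> P (D @^-1` B) = normal_prob 0 s B) ->
  (forall E B, G E -> measurable B ->
     P (E `&` D @^-1` B) = (P E * P (D @^-1` B))%E) ->
  (\int[P]_w (U w * expR (xi w * D w - xi w ^+ 2 * s ^+ 2 / 2))%:E =
   \int[P]_w (U w)%:E)%E.
Proof.
move=> s0 mUG U0 mxiG mD DN Dind.
pose phi w := (U w, xi w).
have mphiG : measurable_fun setT (phi : g_sigma_algebraType G -> R * R).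
  exact: measurable_fun_pair.
have mphi : measurable_fun setT phi by exact: sub_sigma_measurable mphiG.
have mD' : measurable_fun setT (D : Omega -> measurableTypeR R) by exact: mD.
have mpsi : measurable_fun setT
    (fun w => (phi w, D w) : (R * R) * measurableTypeR R).
  exact: measurable_fun_pair.
pose X : {mfun Omega >-> (R * R)%type} :=
  HB.pack phi (isMeasurableFun.Build _ _ _ _ _ mphi).
pose Y : {mfun Omega >-> ((R * R) * measurableTypeR R)%type} :=
  HB.pack (fun w => (phi w, D w)) (isMeasurableFun.Build _ _ _ _ _ mpsi).
pose m1 : probability _ R := distribution P X.
pose m2 : probability _ R := normal_prob 0 s.
have prodE A : measurable A -> (m1 \x m2)%E A = distribution P Y A.
  apply: product_measure_unique => E B mE mB.
  transitivity (P (phi @^-1` E `&` D @^-1` B)); first by [].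
  rewrite Dind//; last exact: sub_sigma_preimage.
  by congr (_ * _)%E; exact: DN.
(* Tonelli needs an integrand that is nonnegative at every point of the product space, hence the
   absolute value; it has no effect along [U], which is nonnegative. *)
pose f (p : (R * R) * measurableTypeR R) : \bar R :=
  (`|p.1.1| * expR (p.1.2 * p.2 - p.1.2 ^+ 2 * s ^+ 2 / 2))%:E.
have m11 : measurable_fun setT (fun p : (R * R) * measurableTypeR R => p.1.1).
  exact: (measurableT_comp measurable_fst).
have m12 : measurable_fun setT (fun p : (R * R) * measurableTypeR R => p.1.2).
  exact: (measurableT_comp measurable_snd).
have mf : measurable_fun setT f.
  apply/measurable_EFinP/measurable_funM; first exact: measurableT_comp.
  apply: measurableT_comp => //; apply: measurable_funB.
    exact: measurable_funM.
  by do 2! apply: measurable_funM => //; exact: measurable_funX.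
have f0 p : (0 <= f p)%E by rewrite lee_fin mulr_ge0 ?expR_ge0.
transitivity (\int[distribution P Y]_p f p)%E.
  rewrite ge0_integral_distribution//.
  by apply: eq_integral => w _; rewrite /f /= ger0_norm.
transitivity (\int[m1 \x m2]_p f p)%E.
  by apply: eq_measure_integral => A mA _; apply/esym/prodE.
rewrite fubini_tonelli1//.
transitivity (\int[m1]_x `|x.1|%:E)%E; last first.
  rewrite ge0_integral_distribution//.
    by apply: eq_integral => w _; rewrite /= ger0_norm.
  exact/measurable_EFinP/measurableT_comp.
apply: eq_integral => -[u x] _; rewrite /fubini_F /f /=.
under eq_integral => y _.
  rewrite expRD mulrA mulrAC EFinM.
  over.
rewrite ge0_integralZl//.
(* With the pair frozen at [(u, x)], the factor [expR (- (x ^+ 2 * s ^+ 2 / 2))] is the inverse of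
   the Gaussian exponential moment, so only [u] remains. *)
- rewrite normal_mgf// -EFinM; congr EFin.
  by rewrite -[LHS]mulrA -expRD addNr expR0 mulr1.
- by apply/measurable_EFinP/measurableT_comp => //; exact: measurable_funM.
Qed.
End exponential_freezing.

(** * Elementary integrals *)

Lemma le_steps (R : realType) (p : nat -> R) (m i j : nat) :
  (forall k, (k < m)%N -> p k <= p k.+1) -> (i <= j)%N -> (j <= m)%N -> p i <= p j.
Proof.
move=> nd ij; rewrite -(subnKC ij); elim: (j - i)%N => [|k IH] jm.
  by rewrite addn0.
by rewrite addnS in jm *; apply: le_trans (IH (ltnW jm)) _; exact: nd.
Qed.

Section simple_exponential.
Context d (Omega : measurableType d) (R : realType) (P : probability Omega R).
Variables (T : R) (Ft : R -> set (set Omega)) (W : R -> Omega -> R).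
Hypothesis filtrationF : filtration T Ft.
Hypothesis brownianW : brownian_motion P T Ft W.
Variable H : simple_process T Ft.

Lemma sp_time_itv k : (k <= sp_size H)%N -> 0 <= sp_time H k <= T.
Proof.
move=> kn; apply/andP; split.
  by apply: le_trans (sp_time_ge0 H) _; exact: (le_steps (@sp_time_nd _ _ _ _ _ H)).
by apply: le_trans (sp_time_leT H); exact: (le_steps (@sp_time_nd _ _ _ _ _ H)).
Qed.

Variables (s t : R).
Hypotheses (s0 : 0 <= s) (st : s <= t) (tT : t <= T).

(* Over [s, t] the process [H] takes the value [sp_coef H k] on the interval from
   [sp_clamp k] to [sp_clamp k.+1]. *)
Definition clamp (x : R) := Num.max s (Num.min x t).

Lemma clamp_itv x : s <= clamp x <= t.
Proof. by rewrite /clamp le_max lexx/= ge_max st ge_min lexx orbT. Qed.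

Lemma clamp_itvT x : 0 <= clamp x <= T.
Proof.
have /andP[a b] := clamp_itv x.
by rewrite (le_trans s0 a) (le_trans b tT).
Qed.

Lemma clamp_le x y : x <= y -> clamp x <= clamp y.
Proof.
move=> xy; rewrite /clamp ge_max le_max lexx/= le_max; apply/orP; right.
by rewrite le_min !ge_min xy lexx orbT.
Qed.

Definition sp_clamp k := clamp (sp_time H k).

(** This is the integral of the squared simple process over [[s, t]], that is, the quadratic
    variation there of its elementary integral. *)
Definition sp_variation (w : Omega) : R := \sum_(k < sp_size H)
  sp_coef H k w ^+ 2 * (sp_clamp k.+1 - sp_clamp k).

Lemma sp_integral_clamp w : sp_integral H W t w - sp_integral H W s w =
  \sum_(k < sp_size H) sp_coef H k w * (W (sp_clamp k.+1) w - W (sp_clamp k) w).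
Proof.
(* If [x <= s], both minima are [x] and the first two terms cancel; otherwise the second minimum is
   [s] and [clamp x] is [Num.min x t]. *)
have E x : W (clamp x) w = W (Num.min x t) w - W (Num.min x s) w + W s w.
  rewrite /clamp; case: (leP x s) => xs.
    rewrite (min_idPl (le_trans xs st)) (max_idPl xs).
    by rewrite subrr add0r.
  rewrite subrK (max_idPr _)//.
  by rewrite le_min st (ltW xs).
rewrite /sp_integral -sumrB; apply: eq_bigr => k _.
by rewrite /sp_clamp !E; ring.
Qed.

(** The logarithm of the exponential martingale of [lam] times the elementary integral, started at
    [s] and observed at time [sp_clamp k]. *)
Definition sp_exponent (lam : R) (k : nat) (w : Omega) : R :=
  \sum_(j < k) (lam * sp_coef H j w * (W (sp_clamp j.+1) w - W (sp_clamp j) w)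
   - (lam * sp_coef H j w) ^+ 2 * (sp_clamp j.+1 - sp_clamp j) / 2).

Let Ftm x : 0 <= x <= T -> Ft x `<=` measurable.
Proof. by move=> x0T; case: filtrationF => _ + _; apply. Qed.
Let Fts x : 0 <= x <= T -> sigma_algebra setT (Ft x).
Proof. by move=> x0T; case: filtrationF => + _ _; apply. Qed.
Let Ftle x y : 0 <= x -> x <= y -> y <= T -> Ft x `<=` Ft y.
Proof. by case: filtrationF => _ _; apply. Qed.

(** By induction on [k]: the next factor has conditional mean 1 given the past. Measurability with
    respect to the current sigma-algebra is carried along, since it is what allows the past to be
    frozen. *)
Lemma sp_exponential_martingale lam k : (k <= sp_size H)%N ->
  measurable_fun setT
    (sp_exponent lam k : g_sigma_algebraType (Ft (sp_clamp k)) -> R) /\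
  (\int[P]_w (expR (sp_exponent lam k w))%:E = 1)%E.
Proof.
elim: k => [_|k IH kn].
  have -> : sp_exponent lam 0 = cst 0.
    by apply/funext => w; rewrite /sp_exponent big_ord0.
  split; first exact: measurable_cst.
  under eq_integral do rewrite /= expR0.
  by rewrite integral_cst// mul1e; exact: probability_setT.
have [mE intE] := IH (ltnW kn).
pose u := sp_clamp k; pose v := sp_clamp k.+1.
pose X w := lam * sp_coef H k w * (W v w - W u w)
   - (lam * sp_coef H k w) ^+ 2 * (v - u) / 2.
have ES w : sp_exponent lam k.+1 w = sp_exponent lam k w + X w.
  by rewrite /sp_exponent big_ord_recr.
have uT := clamp_itvT (sp_time H k); have vT := clamp_itvT (sp_time H k.+1).
have uv : u <= v by apply/clamp_le/sp_time_nd.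
(* A step that clamping collapses contributes the factor 1; it is set apart because the Gaussian
   lemma requires a nonzero deviation. *)
have [uveq|/eqP uvneq] := pselect (u = v).
  have -> : sp_exponent lam k.+1 = sp_exponent lam k.
    apply/funext => w; rewrite ES /X uveq !subrr.
    by rewrite !mulr0 mul0r subrr addr0.
  by split=> //; rewrite -/v -uveq.
have {uvneq}uv' : u < v by rewrite lt_neqAle uvneq.
have /andP[k0 kT] := sp_time_itv (ltnW kn).
(* The coefficient is known at [sp_time H k] and must be known at [u]. The inequality could fail
   only when [sp_time H k] exceeds [t], but then both ends are clamped to [t], against [u < v]. *)
have ku : sp_time H k <= u.
  rewrite /u /sp_clamp /clamp; case: (leP (sp_time H k) t) => [_|tk].
    by rewrite le_max lexx orbT.
  move: uv'; rewrite ltNge => /negP; case.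
  have -> : u = t by rewrite /u /sp_clamp /clamp (min_idPr (ltW tk)) (max_idPr st).
  by have /andP[] := clamp_itv (sp_time H k.+1).
have [aW _ _ normW indW] := brownianW.
have mxi : measurable_fun setT (sp_coef H k : g_sigma_algebraType (Ft u) -> R).
  apply: (@sub_sigma_le _ _ (Ft (sp_time H k))) (sp_coef_meas kn).
  - by apply: Fts; rewrite k0.
  - exact: Fts.
  - by apply: Ftle => //; case/andP: uT.
have mlxi : measurable_fun setT
    ((fun w => lam * sp_coef H k w) : g_sigma_algebraType (Ft u) -> R).
  exact: measurable_funM.
have up d' (T' : measurableType d') (f : Omega -> T') :
    measurable_fun setT (f : g_sigma_algebraType (Ft u) -> T') ->
    measurable_fun setT (f : g_sigma_algebraType (Ft v) -> T').
  apply: sub_sigma_le; [exact: Fts|exact: Fts|].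
  by apply: Ftle; [case/andP: uT| |case/andP: vT].
have mD : measurable_fun setT
    ((fun w => W v w - W u w) : g_sigma_algebraType (Ft v) -> R).
  by apply: measurable_funB; [exact: aW|apply: up; exact: aW].
split.
  rewrite (_ : sp_exponent lam k.+1 = fun w => sp_exponent lam k w + X w); last first.
    exact/funext.
  apply: measurable_funD; first exact: up.
  apply: measurable_funB.
    by apply: measurable_funM => //; exact: up.
  apply: measurable_funM => //; apply: measurable_funM => //.
  by apply: measurable_funX; exact: up.
rewrite -intE.
have vu0 : 0 < v - u by rewrite subr_gt0.
rewrite -(@integral_expR_indep_normal _ _ _ P (Ft u) _ _
  (fun w => expR (sp_exponent lam k w))
  (fun w => lam * sp_coef H k w) (fun w => W v w - W u w) (Num.sqrt (v - u)))//.
- by apply: eq_integral => w _; rewrite ES expRD (sqr_sqrtr (ltW vu0)).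
- exact: Fts.
- exact: Ftm.
- by rewrite gt_eqF// sqrtr_gt0.
- exact: measurableT_comp.
- by apply: sub_sigma_measurable mD; [exact: Fts|exact: Ftm].
- by move=> B mB; apply: normW => //; [case/andP: uT|case/andP: vT].
- by move=> E B FE mB; apply: indW => //; [case/andP: uT|case/andP: vT].
Qed.

Lemma sp_integral_mgf lam :
  (\int[P]_w (expR (lam * (sp_integral H W t w - sp_integral H W s w)
     - lam ^+ 2 / 2 * sp_variation w))%:E = 1)%E.
Proof.
have [_ <-] := @sp_exponential_martingale lam _ (leqnn _).
apply: eq_integral => w _; congr ((expR _)%:E).
rewrite sp_integral_clamp /sp_exponent /sp_variation !mulr_sumr -sumrB.
by apply: eq_bigr => k _; field.
Qed.

End simple_exponential.

Lemma measurable_superlevel d (Omega : measurableType d) (R : realType)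
    (f : Omega -> R) (c : R) :
  measurable_fun setT f -> measurable [set w | c <= f w].
Proof.
move=> mf; have -> : [set w | c <= f w] = f @^-1` `[c, +oo[.
  by apply/seteqP; split => w /=; rewrite in_itv/= andbT.
by rewrite -[X in measurable X]setTI; exact: mf.
Qed.

(** On the event, [expR (L w)] is at least [expR c], and its integral over the event is at most
    1. *)
Lemma exponential_markov d (Omega : measurableType d) (R : realType)
    (P : probability Omega R) (L : Omega -> R) (c : R) :
  measurable_fun setT L -> (\int[P]_w (expR (L w))%:E = 1)%E ->
  (P [set w | (c <= L w)%R] <= (expR (- c))%:E)%E.
Proof.
move=> mL intL; set A := [set w | _].
have mA : measurable A by exact: measurable_superlevel.
have meL : measurable_fun setT (fun w => (expR (L w))%:E).
  exact/measurable_EFinP/measurableT_comp.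
suff : ((expR c)%:E * P A <= 1)%E.
  by rewrite expRN -lee_pdivlMl ?expR_gt0// mule1.
rewrite -intL -integral_cst//.
have AT : (\int[P]_(w in A) (expR (L w))%:E <= \int[P]_w (expR (L w))%:E)%E.
  by apply: ge0_subset_integral => // w _; rewrite lee_fin expR_ge0.
apply: le_trans AT; apply: ge0_le_integral => //.
- by move=> w _; rewrite /= lee_fin expR_ge0.
- exact: measurable_funTS.
- by move=> w /= cL; rewrite lee_fin ler_expR.
Qed.

(** * Joint measurability in time and outcome *)

Section parametric_integral.
Context d (Omega : measurableType d) (R : realType).
Notation mu := (@lebesgue_measure R).

(* [measurableTypeR R] is the structure on which [lebesgue_measure] is defined. *)
Definition jointly_measurable (D : set R) (f : R -> Omega -> R) :=
  measurable_fun (D `*` setT) (fun p : measurableTypeR R * Omega => f p.1 p.2).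

Lemma jointly_measurable_section (D : set R) f w : measurable D ->
  jointly_measurable D f -> measurable_fun D (f ^~ w : measurableTypeR R -> R).
Proof.
move=> mD mf mD' B mB.
have mX : measurable (D `*` setT : set (measurableTypeR R * Omega)).
  exact: measurableX.
have := @pair2_measurable _ _ (measurableTypeR R) Omega w measurableT _ (mf mX _ mB).
rewrite setTI; congr (measurable _); apply/seteqP; split => x /=.
  by move=> [[? _] ?].
by move=> [? ?].
Qed.

(** Extending the integrand by zero outside [D] gives a nonnegative measurable function on the whole
    product, to which Tonelli's theorem applies. *)
Lemma measurable_fun_integral_param (D : set R) (f : R -> Omega -> R) :
  measurable D -> jointly_measurable D f -> (forall r w, 0 <= f r w) ->
  measurable_fun setT (fun w => (\int[mu]_(r in D) (f r w)%:E)%E).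
Proof.
move=> mD mf f0.
have mX : measurable (D `*` setT : set (measurableTypeR R * Omega)).
  exact: measurableX.
pose F : measurableTypeR R * Omega -> \bar R :=
  (fun p => (f p.1 p.2)%:E) \_ (D `*` setT).
have mF : measurable_fun setT F.
  by apply/(measurable_restrictT _ _).1 => //; exact/measurable_EFinP.
have F0 p : (0 <= F p)%E.
  by rewrite /F patchE; case: ifP => // _; rewrite lee_fin.
rewrite (_ : (fun w => _) = fubini_G mu F).
  exact: measurable_fun_fubini_tonelli_G.
apply/funext => w; rewrite /fubini_G [LHS]integral_mkcond.
apply: eq_integral => r _; rewrite /F !patchE.
by congr (if _ then _ else _); apply/idP/idP; rewrite !inE => // -[].
Qed.

(** Progressive measurability is taken at the final time [T] and composed with the identity of
    [Omega], which is measurable into the coarser sigma-algebra [Ft T]. *)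
Lemma progressively_measurable_joint (T : R) Ft (sigma : R -> Omega -> R) :
  0 <= T -> filtration T Ft -> progressively_measurable T Ft sigma ->
  jointly_measurable `[0, T] sigma.
Proof.
move=> T0 [sF Fm _] /(_ T); rewrite T0 lexx => /(_ isT) mf mD B mB.
have TT : 0 <= T <= T by rewrite T0 lexx.
have mX : measurable (`[0, T] `*` setT : set (R * g_sigma_algebraType (Ft T))).
  exact: measurableX.
have mid : measurable_fun setT (id : Omega -> g_sigma_algebraType (Ft T)).
  move=> _ E mE; rewrite setTI; apply: (Fm T) => //.
  by rewrite measurable_g_measurableTypeE in mE => //; exact: sF.
have mid2 : measurable_fun setT
    (fun p : measurableTypeR R * Omega =>
       (p.1, p.2) : R * g_sigma_algebraType (Ft T)).
  apply: measurable_fun_pair; first exact: measurable_fst.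
  exact: (measurableT_comp mid measurable_snd).
have := mid2 measurableT _ (mf mX _ mB).
by rewrite setTI; congr (measurable _); apply/seteqP; split => -[r w] /=.
Qed.

End parametric_integral.

(** * Simple processes: variation, comparison with [sigma], measurability *)

Lemma sqr_sum_indic_itv (R : realType) (p c : nat -> R) (m : nat) (x : R) :
  (forall k, (k < m)%N -> p k <= p k.+1) ->
  (\sum_(k < m) c k * \1_(`]p k, p k.+1]) x) ^+ 2 =
  \sum_(k < m) c k ^+ 2 * \1_(`]p k, p k.+1]) x.
Proof.
elim: m => [|m IH] pnd; first by rewrite !big_ord0 expr0n.
have pnd' k : (k < m)%N -> p k <= p k.+1 by move=> km; apply/pnd/ltnW.
rewrite !big_ord_recr/= -IH//; set S := \sum_(_ < _) _.
have -> : \1_(`]p m, p m.+1]) x = (p m < x <= p m.+1)%R%:R :> R.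
  rewrite indicE; congr (nat_of_bool _)%:R.
  by apply/idP/idP; rewrite inE/= in_itv.
case: (boolP (p m < x <= p m.+1)) => [|_]; last by rewrite !mulr0 !addr0.
move => /andP[pmx _].
(* When [x] lies in the last interval, all earlier ones end at or before [p m < x]: their indicators
   vanish and no cross term survives. *)
suff -> : S = 0 by rewrite !mulr1 add0r expr0n add0r.
rewrite /S big1// => k _; rewrite indicE memNset ?mulr0//= in_itv/=.
apply/negP; rewrite negb_and -!leNgt -ltNge; apply/orP; right.
apply: le_lt_trans pmx.
exact: (le_steps pnd' (ltn_ord k)).
Qed.

Section simple_variation.
Context d (Omega : measurableType d) (R : realType).
Variables (T : R) (Ft : R -> set (set Omega)) (H : simple_process T Ft).
Notation mu := (@lebesgue_measure R).

Lemma sp_fun_sqr r w : sp_fun H r w ^+ 2 =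
  \sum_(k < sp_size H) sp_coef H k w ^+ 2 * \1_(`]sp_time H k, sp_time H k.+1]) r.
Proof.
exact: (sqr_sum_indic_itv (fun k => sp_coef H k w) r (@sp_time_nd _ _ _ _ _ H)).
Qed.

(** The indicators are disjoint, so the square expands without cross terms; each clamped step lies
    inside both its original interval and [[s, t]]. *)
Lemma sp_variation_le (s t : R) w : s <= t ->
  ((sp_variation H s t w)%:E <=
   \int[mu]_(r in `[s, t]) (sp_fun H r w ^+ 2)%:E)%E.
Proof.
move=> st.
under eq_integral do rewrite sp_fun_sqr -sumEFin.
rewrite ge0_integral_sum//; last 2 first.
- by move=> k; apply/measurable_EFinP; apply: measurable_funM.
- by move=> k r _; rewrite lee_fin mulr_ge0 ?sqr_ge0.
rewrite /sp_variation -sumEFin; apply: lee_sum => k _.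
under eq_integral do rewrite EFinM.
rewrite ge0_integralZl_EFin ?sqr_ge0//; last exact/measurable_EFinP.
rewrite EFinM lee_wpmul2l ?lee_fin ?sqr_ge0// integral_indic//=.
have le_u : sp_clamp H s t k <= sp_clamp H s t k.+1.
  by apply/clamp_le/sp_time_nd.
apply: (@le_trans _ _ (mu `]sp_clamp H s t k, sp_clamp H s t k.+1])).
  rewrite lebesgue_measure_itv/= lte_fin; case: ltP => [_|]; first by rewrite EFinB.
  by rewrite lee_fin subr_le0.
apply: le_measure; rewrite ?inE//; first exact: measurableI.
move=> r /=; rewrite !in_itv/= => /andP[ukr ruk].
have /andP[su _] := clamp_itv st (sp_time H k).
have /andP[_ ut] := clamp_itv st (sp_time H k.+1).
have rt : r <= t := le_trans ruk ut.
have sr : s < r := le_lt_trans su ukr.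
rewrite rt (ltW sr); split => //; apply/andP; split.
  move: ukr; rewrite /sp_clamp /clamp gt_max => /andP[_].
  by rewrite gt_min => /orP[//|]; rewrite ltNge rt.
by move: ruk; rewrite /sp_clamp /clamp le_max leNgt sr/= le_min => /andP[].
Qed.

Hypothesis filtrationF : filtration T Ft.

Lemma measurable_sp_coef k : (k < sp_size H)%N -> measurable_fun setT (sp_coef H k).
Proof.
have [sF Fm _] := filtrationF.
move=> kn; have kT := sp_time_itv (ltnW kn).
by apply: sub_sigma_measurable (sp_coef_meas kn); [exact: sF|exact: Fm].
Qed.

Lemma jointly_measurable_sp_fun D : measurable D -> jointly_measurable D (sp_fun H).
Proof.
move=> mD; apply: measurable_funTS; apply: measurable_sum => k.
apply: measurable_funM.
  by apply: (measurableT_comp (measurable_sp_coef (ltn_ord k))); exact: measurable_snd.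
apply: (@measurableT_comp _ _ _ _ _ _
  (\1_(`]sp_time H k, sp_time H k.+1]) : measurableTypeR R -> R)) => //.
Qed.

(** Pointwise [H^2 <= 2 sigma^2 + 2 (H - sigma)^2], the difference being the square of
    [H - 2 sigma]. The error is then integrated over all of [[0, T]], where it is known to tend to 0
    in probability. *)
Lemma sp_integral_sqr_le (sigma : R -> Omega -> R) (s t : R) w :
  jointly_measurable `[0, T] sigma -> 0 <= s -> t <= T ->
  (\int[mu]_(r in `[s, t]) (sp_fun H r w ^+ 2)%:E <=
   2%:E * \int[mu]_(r in `[s, t]) (sigma r w ^+ 2)%:E +
   2%:E * \int[mu]_(r in `[0%R, T]) ((sp_fun H r w - sigma r w) ^+ 2)%R%:E)%E.
Proof.
move=> msig s0 tT.
have sub : `[s, t] `<=` `[0, T].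
  move=> r /=; rewrite !in_itv/= => /andP[sr rt].
  by rewrite (le_trans s0 sr) (le_trans rt tT).
have mH := jointly_measurable_section w (measurable_itv _)
  (jointly_measurable_sp_fun (measurable_itv _)).
have ms := jointly_measurable_section w (measurable_itv _) msig.
have mH2 : measurable_fun `[0, T] (fun r => (sp_fun H r w ^+ 2)%:E).
  exact/measurable_EFinP/measurable_funX.
have ms2 : measurable_fun `[0, T] (fun r => (sigma r w ^+ 2)%:E).
  exact/measurable_EFinP/measurable_funX.
have md2 : measurable_fun `[0, T] (fun r => ((sp_fun H r w - sigma r w) ^+ 2)%R%:E).
  by apply/measurable_EFinP/measurable_funX; exact: measurable_funB.
apply: (@le_trans _ _ (2%:E * \int[mu]_(r in `[s, t]) (sigma r w ^+ 2)%:E +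
   2%:E * \int[mu]_(r in `[s, t]) ((sp_fun H r w - sigma r w) ^+ 2)%R%:E)%E); last first.
  apply: leeD2l; apply: lee_wpmul2l => //.
  by apply: ge0_subset_integral => // r _; rewrite lee_fin sqr_ge0.
have sm (f : R -> \bar R) : measurable_fun `[0, T] f -> measurable_fun `[s, t] f.
  exact: measurable_funS.
have Z (f : R -> R) : measurable_fun `[0, T] (fun r => (f r ^+ 2)%:E) ->
    (2%:E * \int[mu]_(r in `[s, t]) (f r ^+ 2)%:E =
     \int[mu]_(r in `[s, t]) (2%:E * (f r ^+ 2)%:E))%E.
  move=> mf; rewrite ge0_integralZl_EFin//; last exact: sm.
  by move=> r _; rewrite lee_fin sqr_ge0.
rewrite (Z (sigma ^~ w))// (Z (fun r => sp_fun H r w - sigma r w))//.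
have m1 : measurable_fun `[s, t] (fun r => (2%:E * (sigma r w ^+ 2)%:E)%E).
  by apply: measurable_funeM; exact: sm.
have m2 : measurable_fun `[s, t]
    (fun r => (2%:E * ((sp_fun H r w - sigma r w) ^+ 2)%:E)%E).
  by apply: measurable_funeM; exact: sm.
rewrite -ge0_integralD//; first last.
- by move=> r _; rewrite -EFinM lee_fin mulr_ge0 ?sqr_ge0.
- by move=> r _; rewrite -EFinM lee_fin mulr_ge0 ?sqr_ge0.
apply: ge0_le_integral => //.
- by move=> r _; rewrite lee_fin sqr_ge0.
- exact: sm.
- exact: emeasurable_funD.
move=> r _; rewrite -!EFinM -EFinD lee_fin -subr_ge0.
by rewrite [X in 0 <= X](_ : _ = (sp_fun H r w - 2 * sigma r w) ^+ 2) ?sqr_ge0//; ring.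
Qed.

Variables (P : probability Omega R) (W : R -> Omega -> R).
Hypothesis brownianW : brownian_motion P T Ft W.

Lemma measurable_brownian t : 0 <= t <= T -> measurable_fun setT (W t).
Proof.
have [sF Fm _] := filtrationF; have [aW _ _ _ _] := brownianW.
by move=> tT; apply: sub_sigma_measurable (aW _ tT); [exact: sF|exact: Fm].
Qed.

Lemma measurable_sp_integral t : 0 <= t <= T ->
  measurable_fun setT (sp_integral H W t).
Proof.
move=> /andP[t0 tT]; apply: measurable_sum => k.
have itv j : (j <= sp_size H)%N -> 0 <= Num.min (sp_time H j) t <= T.
  move=> /sp_time_itv/andP[a b].
  by rewrite le_min a t0 ge_min b.
apply: measurable_funM; first exact: measurable_sp_coef.
by apply: measurable_funB; apply: measurable_brownian; apply: itv => //; exact: ltnW.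
Qed.

Lemma measurable_sp_variation s t : measurable_fun setT (sp_variation H s t).
Proof.
apply: measurable_sum => k; apply: measurable_funM => //.
by apply: measurable_funX; exact: measurable_sp_coef.
Qed.

End simple_variation.

(** * Tail bound for the Ito integral *)

Section ito_tail.
Context d (Omega : measurableType d) (R : realType) (P : probability Omega R).
Variables (T : R) (Ft : R -> set (set Omega)) (W sigma Y : R -> Omega -> R).
Hypothesis T0 : 0 <= T.
Hypothesis filtrationF : filtration T Ft.
Hypothesis brownianW : brownian_motion P T Ft W.
Hypothesis progressive_sigma : progressively_measurable T Ft sigma.
Hypothesis itoY : ito_integral P T Ft W sigma Y.
Notation mu := (@lebesgue_measure R).

Let msig : jointly_measurable `[0, T] sigma.
Proof. exact: progressively_measurable_joint filtrationF progressive_sigma. Qed.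

Let jm_sub (D D' : set R) (f : R -> Omega -> R) : measurable D' ->
  D `<=` D' -> jointly_measurable D' f -> jointly_measurable D f.
Proof.
move=> mD' DD'; apply: measurable_funS; first exact: measurableX.
by apply: setSX.
Qed.

Lemma measurable_integral_sqr (s t : R) : 0 <= s -> t <= T ->
  measurable_fun setT (fun w => (\int[mu]_(r in `[s, t]) (sigma r w ^+ 2)%:E)%E).
Proof.
move=> s0 tT; apply: measurable_fun_integral_param => //; last first.
  by move=> *; exact: sqr_ge0.
apply: measurable_funX; apply: (jm_sub _ _ msig) => //.
move=> r /=; rewrite !in_itv/= => /andP[sr rt].
by rewrite (le_trans s0 sr) (le_trans rt tT).
Qed.

Lemma measurable_ito t : 0 <= t <= T -> measurable_fun setT (Y t).
Proof. by case: itoY => mY _ _; exact: mY. Qed.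

Let bounded_variation (s t v : R) : set Omega :=
  [set w | (\int[mu]_(r in `[s, t]) (sigma r w ^+ 2)%:E <= v%:E)%E].

Let measurable_bounded_variation s t v : 0 <= s -> t <= T ->
  measurable (bounded_variation s t v).
Proof.
move=> s0 tT; rewrite -[X in measurable X]setTI.
exact: (emeasurable_fun_infty_c measurableT (measurable_integral_sqr s0 tT)).
Qed.

(** The integral of [sigma ^+ 2] is random; putting its bound into the event localizes the estimate,
    so that the tail depends only on the constants [x] and [v]. *)
Definition large_increment (s t x v : R) : set Omega :=
  [set w | x <= `|Y t w - Y s w|] `&` bounded_variation s t v.

Let signed_increment (e s t x v : R) : set Omega :=
  [set w | x <= e * (Y t w - Y s w)] `&` bounded_variation s t v.

Let measurable_ito_increment s t : 0 <= s -> s <= t -> t <= T ->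
  measurable_fun setT (fun w => Y t w - Y s w).
Proof.
move=> s0 st tT; apply: measurable_funB; apply: measurable_ito.
  by rewrite tT (le_trans s0 st).
by rewrite s0 (le_trans st tT).
Qed.

Lemma measurable_large_increment s t x v : 0 <= s -> s <= t -> t <= T ->
  measurable (large_increment s t x v).
Proof.
move=> s0 st tT; apply: measurableI; last exact: measurable_bounded_variation.
by apply/measurable_superlevel/measurableT_comp => //; exact: measurable_ito_increment.
Qed.

Let measurable_signed_increment e s t x v : 0 <= s -> s <= t -> t <= T ->
  measurable (signed_increment e s t x v).
Proof.
move=> s0 st tT; apply: measurableI; last exact: measurable_bounded_variation.
by apply/measurable_superlevel/measurable_funM => //; exact: measurable_ito_increment.
Qed.

(* Outside three events of vanishing probability, the increment of [Y] is close
   to that of the elementary integral of [H n], whose variation is at most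
   [4 v]; then the exponent [L n] of the exponential martingale of [H n] with
   parameter [e * x / (8 v)] is at least [x^2 / (32 v)]. *)
Lemma ito_signed_tail (e s t x v : R) : `|e| = 1 ->
  0 <= s -> s <= t -> t <= T -> 0 < x -> 0 < v ->
  (P (signed_increment e s t x v) <= (expR (- (x ^+ 2 / (32 * v))))%:E)%E.
Proof.
move=> e1 s0 st tT x0 v0; set A := signed_increment e s t x v.
have [mY _ [H [cvH cvI]]] := itoY.
have tT' : 0 <= t <= T by rewrite tT (le_trans s0 st).
have sT' : 0 <= s <= T by rewrite s0 (le_trans st tT).
have mA : measurable A by exact: measurable_signed_increment.
(* An error below [x / 4] at each of the two endpoints leaves at least [x / 2] of the increment. *)
pose far r n := [set w | ((x / 4)%:E <= `|(sp_integral (H n) W r w - Y r w)%:E|)%E].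
pose bad n := [set w | (v%:E <= `|\int[mu]_(r in `[0%R, T])
   ((sp_fun (H n) r w - sigma r w) ^+ 2)%R%:E|)%E].
have mabs (f : Omega -> \bar R) (c : R) : measurable_fun setT f ->
    measurable [set w | (c%:E <= `|f w|)%E].
  move=> mf; have maf : measurable_fun setT (fun w => `|f w|)%E.
    exact: measurableT_comp.
  by have := emeasurable_fun_c_infty measurableT maf c%:E; rewrite setTI.
have mfar r n : 0 <= r <= T -> measurable (far r n).
  move=> rT; apply: mabs; apply/measurable_EFinP; apply: measurable_funB.
    exact: (measurable_sp_integral (H n) filtrationF brownianW).
  exact: measurable_ito.
have mbad n : measurable (bad n).
  apply: mabs; apply: measurable_fun_integral_param => //; last first.
    by move=> *; exact: sqr_ge0.
  apply: measurable_funX; apply: measurable_funB => //.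
  exact: (jointly_measurable_sp_fun (H n) filtrationF).
(* This value maximizes [lam * (x / 2) - lam ^+ 2 / 2 * (4 * v)]; the maximum is the constant [c]
   below. *)
pose lam := x / (8 * v).
pose L n w := (e * lam) * (sp_integral (H n) W t w - sp_integral (H n) W s w)
  - (e * lam) ^+ 2 / 2 * sp_variation (H n) s t w.
pose c := x ^+ 2 / (32 * v).
have mL n : measurable_fun setT (L n).
  apply: measurable_funB; apply: measurable_funM => //.
    apply: measurable_funB;
      exact: (measurable_sp_integral (H n) filtrationF brownianW).
  exact: (measurable_sp_variation (H n) filtrationF).
have mcL n : measurable [set w | c <= L n w] by exact: measurable_superlevel.
have e21 : e ^+ 2 = 1 by rewrite -real_normK ?num_real// e1 expr1n.
have sub n : A `<=` (far t n `|` far s n) `|` (bad n `|` [set w | c <= L n w]).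
  move=> w [/= xY sv].
  have [ft|nft] := pselect (far t n w); first by left; left.
  have [fs|nfs] := pselect (far s n w); first by left; right.
  have [bw|nbw] := pselect (bad n w); first by right; left.
  right; right => /=.
  move: nft nfs => /negP + /negP; rewrite /far /= !lee_fin -!ltNge => It Is.
  have dI : x / 2 <= e * (sp_integral (H n) W t w - sp_integral (H n) W s w).
    set a := sp_integral (H n) W t w in It *.
    set b := sp_integral (H n) W s w in Is *.
    have : e * (Y t w - Y s w) - e * (a - b) <= `|a - Y t w| + `|b - Y s w|.
      have -> : e * (Y t w - Y s w) - e * (a - b) =
          e * ((b - Y s w) - (a - Y t w)) by ring.
      apply: le_trans (ler_norm _) _; rewrite normrM e1 mul1r [leRHS]addrC.
      exact: ler_normB.
    move: xY It Is; move: (e * (Y t w - Y s w)) (e * (a - b)) `|_| `|_| => *.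
    lra.
  (* One [2 * v] comes from the variation bound contained in [A], the other from being outside
     [bad n]. *)
  have Qv : sp_variation (H n) s t w <= 4 * v.
    rewrite -lee_fin; apply: le_trans (sp_variation_le (H n) w st) _.
    apply: le_trans (sp_integral_sqr_le (H n) filtrationF w msig s0 tT) _.
    move: nbw => /negP; rewrite /bad /= -ltNge gee0_abs; last first.
      by apply: integral_ge0 => r _; rewrite lee_fin sqr_ge0.
    move=> /ltW nbw.
    apply: (@le_trans _ _ (2%:E * v%:E + 2%:E * v%:E)%E).
      by apply: leeD; apply: lee_wpmul2l.
    by rewrite -!EFinM -EFinD lee_fin; lra.
  rewrite /L exprMn e21 mul1r (mulrC e) -mulrA.
  have lam0 : 0 < lam by rewrite /lam divr_gt0// mulr_gt0.
  have h1 := ler_wpM2l (ltW lam0) dI.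
  have lam2 : 0 <= lam ^+ 2 / 2 by rewrite divr_ge0 ?sqr_ge0.
  have h2 := ler_wpM2l lam2 Qv.
  have -> : c = lam * (x / 2) - lam ^+ 2 / 2 * (4 * v).
    rewrite /c /lam; field; exact: lt0r_neq0.
  by lra.
have PA n : (P A <= (P (far t n) + P (far s n)) + (P (bad n) + (expR (- c))%:E))%E.
  apply: (@le_trans _ _ (P ((far t n `|` far s n) `|` (bad n `|` [set w | c <= L n w])))).
    apply: le_measure; [by rewrite inE| |exact: sub].
    rewrite inE; apply: measurableU; apply: measurableU => //; exact: mfar.
  apply: le_trans (measureU2 _ _ _) _.
    by apply: measurableU; exact: mfar.
    exact: measurableU.
  apply: leeD; first by apply: measureU2; exact: mfar.
  apply: le_trans (measureU2 _ _ _) _ => //.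
  apply: leeD2l; apply: exponential_markov => //.
  exact: (sp_integral_mgf filtrationF brownianW (H n) s0 st tT (e * lam)).
have x40 : 0 < x / 4 by rewrite divr_gt0.
(* The probability of [A] does not depend on [n], while the three error probabilities vanish; only
   the exponential term remains in the limit. *)
have lim : ((P (far t n) + P (far s n)) + (P (bad n) + (expR (- c))%:E))%E @[n --> \oo]
    --> ((0 + 0) + (0 + (expR (- c))%:E))%E.
  apply: cvgeD => //; apply: cvgeD => //.
  - exact: (cvI _ tT' _ x40).
  - exact: (cvI _ sT' _ x40).
  - exact: (cvH _ v0).
  - exact: cvg_cst.
rewrite !add0e in lim.
apply: (@lee_cvg_to _ \oo _ _ (fun _ => P A) _ _ _ (cvg_cst _) lim).
exact: nearW.
Qed.

Lemma ito_increment_tail (s t x v : R) :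
  0 <= s -> s <= t -> t <= T -> 0 < x -> 0 < v ->
  (P (large_increment s t x v) <= (2 * expR (- (x ^+ 2 / (32 * v))))%:E)%E.
Proof.
move=> s0 st tT x0 v0.
pose A e := signed_increment e s t x v.
have mA e : measurable (A e) by exact: measurable_signed_increment.
apply: (@le_trans _ _ (P (A 1 `|` A (-1)))).
  apply: le_measure; rewrite ?inE.
  - exact: measurable_large_increment.
  - exact: measurableU.
  move=> w [/= xY sv]; have [Y0|Y0] := leP 0 (Y t w - Y s w).
    by left; split => //; rewrite /= mul1r -(ger0_norm Y0).
  by right; split => //; rewrite /= mulN1r -(ltr0_norm Y0).
apply: le_trans (measureU2 _ _ _) _ => //.
rewrite mulrDl mul1r EFinD; apply: leeD; apply: ito_signed_tail => //.
  by rewrite normr1.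
by rewrite normrN1.
Qed.

End ito_tail.

(* The term [k = 0] is [0], since [0^-1 = 0]. *)
Lemma sum_inv_sqr_le (R : realType) (n : nat) :
  \sum_(k < n.+1) (k%:R^-1) ^+ 2 <= 2 - n%:R^-1 :> R.
Proof.
case: n => [|n]; first by rewrite big_ord_recl big_ord0 /= !mulr0n !invr0 expr0n /=; lra.
elim: n => [|n IH].
  by rewrite !big_ord_recl big_ord0 /= mulr0n invr0 expr0n mulr1n invr1 expr1n /=; lra.
rewrite big_ord_recr /=; apply: le_trans (lerD IH (lexx _)) _.
set a : R := n.+1%:R; have a0 : 0 < a by rewrite /a ltr0n.
have -> : n.+2%:R = a + 1 :> R by rewrite /a -[n.+2]addn1 natrD.
have a1 : 0 < a + 1 by rewrite addr_gt0.
(* The right side is [a^-1 - (a + 1)^-1], so the bound telescopes; this needs [a > 0], whence the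
   separate treatment of the first values of [n]. *)
have h1 : (a + 1)^-1 ^+ 2 <= a^-1 * (a + 1)^-1.
  rewrite expr2 ler_wpM2r ?invr_ge0 ?(ltW a1)// lef_pV2 ?posrE//; lra.
have h2 : a^-1 * (a + 1)^-1 = a^-1 - (a + 1)^-1 by field; rewrite !gt_eqF.
rewrite h2 in h1; move: h1.
by move: ((a + 1)^-1 ^+ 2) (a^-1) ((a + 1)^-1) => u v z; lra.
Qed.

(** * Borel-Cantelli over the observation grids *)

Section modulus.
Context d (Omega : measurableType d) (R : realType) (P : probability Omega R).
Variables (T : R) (Ft : R -> set (set Omega)) (W sigma Y : R -> Omega -> R).
Hypothesis T0 : 0 < T.
Hypothesis filtrationF : filtration T Ft.
Hypothesis brownianW : brownian_motion P T Ft W.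
Hypothesis progressive_sigma : progressively_measurable T Ft sigma.
Hypothesis itoY : ito_integral P T Ft W sigma Y.
Notation mu := (@lebesgue_measure R).

Let lag (n : nat) : R := T / n%:R.

Let lag_gt0 n : (0 < n)%N -> 0 < lag n.
Proof. by move=> n0; rewrite divr_gt0// ltr0n. Qed.

Lemma obs_time_lag n i : (0 < n)%N -> (i <= n)%N -> 0 <= obs_time (lag n) i <= T.
Proof.
move=> n0 iN; apply/andP; split.
  by rewrite /obs_time mulr_ge0// (ltW (lag_gt0 n0)).
rewrite /obs_time /lag mulrCA -[leRHS]mulr1 ler_wpM2l ?(ltW T0)//.
by rewrite ler_pdivrMr ?ltr0n// mul1r ler_nat.
Qed.

(** Since [96 = 3 * 32], the tail exponent at variation [K.+1%:R * lag n] becomes [3 * ln (lag n)].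
    The cube of the lag remains summable after multiplication by the [n] intervals. *)
Let threshold (K n : nat) : R := Num.sqrt (96 * K.+1%:R * (lag n * ln (lag n)^-1)).

Let large (K n i : nat) : set Omega :=
  large_increment sigma Y (obs_time (lag n) i) (obs_time (lag n) i.+1)
    (threshold K n) (K.+1%:R * lag n).

(** The guard makes the lag smaller than 1, hence its logarithmic factor positive; it discards only
    finitely many [n]. *)
Let some_large (K n : nat) : set Omega :=
  if T < n%:R then \big[setU/set0]_(i < n) large K n i else set0.

(** Boole's inequality: [n] intervals, each contributing at most [2 * (T / n) ^+ 3]. *)
Lemma some_large_bound K n : measurable (some_large K n) /\
  (P (some_large K n) <= (2 * T ^+ 3 * (n%:R^-1) ^+ 2)%:E)%E.
Proof.
rewrite /some_large; case: ifPn => [Tn|_]; last first.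
  by split => //; rewrite measure0 lee_fin !mulr_ge0 ?sqr_ge0 ?exprn_ge0 ?(ltW T0).
have n0 : (0 < n)%N by rewrite -(ltr0n R) (lt_trans T0 Tn).
have h0 := lag_gt0 n0.
have ht i : (i < n)%N -> [/\ 0 <= obs_time (lag n) i,
    obs_time (lag n) i <= obs_time (lag n) i.+1 & obs_time (lag n) i.+1 <= T].
  move=> iN; have /andP[a _] := obs_time_lag n0 (ltnW iN).
  have /andP[_ b] := obs_time_lag n0 iN.
  by split => //; rewrite /obs_time ler_wpM2r ?(ltW h0)// ler_nat.
have ml i : (i < n)%N -> measurable (large K n i).
  move=> /ht[? ? ?].
  exact: (measurable_large_increment (ltW T0) filtrationF progressive_sigma itoY).
split; first by apply: bigsetU_measurable => i _; exact: ml.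
apply: le_trans (Boole_inequality _ ml) _.
have h1 : 1 < (lag n)^-1 by rewrite invf_cp1// /lag ltr_pdivrMr ?ltr0n// mul1r.
have ln0 : 0 < ln (lag n)^-1 by rewrite ln_gt0.
have x2 : 0 < 96 * K.+1%:R * (lag n * ln (lag n)^-1)
  by apply: mulr_gt0; apply: mulr_gt0; rewrite ?ltr0n.
apply: (@le_trans _ _ (\sum_(i < n) (2 * lag n ^+ 3)%:E)%E).
  apply: lee_sum => i _; have [? ? ?] := ht _ (ltn_ord i).
  apply: le_trans (ito_increment_tail (ltW T0) filtrationF brownianW
    progressive_sigma itoY _ _ _ _ _) _ => //.
  - by rewrite sqrtr_gt0.
  - by rewrite mulr_gt0.
  rewrite lee_fin ler_wpM2l// (sqr_sqrtr (ltW x2)).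
  have -> : - (96 * K.+1%:R * (lag n * ln (lag n)^-1) / (32 * (K.+1%:R * lag n)))
      = 3%:R * ln (lag n).
    rewrite lnV ?posrE//; have k0 : 0 < K.+1%:R :> R by rewrite ltr0n.
    by move: K.+1%:R k0 => k k0; field; rewrite !gt_eqF.
  by rewrite expRM_natl lnK ?posrE.
rewrite sumEFin sumr_const card_ord lee_fin /lag.
have n0' : (n%:R : R) != 0 by rewrite pnatr_eq0 -lt0n.
by rewrite -mulr_natl le_eqVlt; apply/orP; left; apply/eqP; field.
Qed.

(** Borel-Cantelli is applied for each [K], followed by a countable intersection. The integer [K]
    stands inside the almost sure event because it is later chosen from the random bound [M w]. *)
Lemma ito_modulus : {ae P, forall w, forall K : nat, exists n0 : nat,
  forall n i : nat, (n0 <= n)%N -> T < n%:R -> (i < n)%N ->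
  let h := T / n%:R in
  (\int[mu]_(r in `[obs_time h i, obs_time h i.+1]) (sigma r w ^+ 2)%:E
     <= (K.+1%:R * h)%:E)%E ->
  `|Y (obs_time h i.+1) w - Y (obs_time h i) w| <
    Num.sqrt (96 * K.+1%:R * (h * ln h^-1))}.
Proof.
apply: ae_foralln => K.
have ms n : measurable (some_large K n) := (some_large_bound K n).1.
have P0 : P (lim_sup_set (some_large K)) = 0%E.
  apply: lim_sup_set_cvg0 => //.
  apply: (@le_lt_trans _ _ (2 * T ^+ 3 * 2)%:E); last exact: ltry.
  apply: lime_le; first by apply: is_cvg_nneseries => n _ _; exact: measure_ge0.
  apply: nearW => n.
  apply: (@le_trans _ _ (\sum_(0 <= k < n) (2 * T ^+ 3 * (k%:R^-1) ^+ 2)%:E)%E).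
    by apply: lee_sum => k _; exact: (some_large_bound K k).2.
  rewrite big_mkord sumEFin lee_fin -mulr_sumr ler_wpM2l//.
    by rewrite mulr_ge0 ?exprn_ge0 ?(ltW T0).
  case: n => [|n]; first by rewrite big_ord0.
  by apply: le_trans (sum_inv_sqr_le R n) _; rewrite lerBlDr lerDl invr_ge0.
exists (lim_sup_set (some_large K)); split => //.
  apply: bigcap_measurable => // k _.
  by apply: bigcup_measurable => j _; exact: ms.
move=> w /= nw; apply: contrapT => nl; apply: nw.
have [m mP] : exists m, forall n, (m <= n)%N -> ~ some_large K n w.
  apply: contrapT => nm; apply: nl => m _.
  apply: contrapT => nmm; apply: nm; exists m => n mn ln.
  by apply: nmm; exists n.
exists m => n i mn Tn iN sv; rewrite ltNge; apply/negP => xY.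
apply: (mP n mn); rewrite /some_large Tn.
rewrite -bigcup_mkord; exists i => //.
Qed.

End modulus.

(** * Counting paths *)

Lemma exists_pos_lower_bound (R : realType) (g : nat -> R) (n : nat) :
  (forall m, (m < n)%N -> 0 < g m) ->
  exists2 e, 0 < e & forall m, (m < n)%N -> e <= g m.
Proof.
elim: n => [_|n IH g0]; first by exists 1.
have [e e0 eg] := IH (fun m mn => g0 m (ltnW mn)).
exists (Num.min e (g n)); first by rewrite lt_min e0 g0.
move=> m; rewrite ltnS leq_eqVlt => /orP[/eqP ->|mn].
  by rewrite ge_min lexx orbT.
by rewrite ge_min eg.
Qed.

Section counting_path.
Variables (R : realType) (T : R) (f : R -> nat).
Hypothesis T0 : 0 < T.
Hypothesis f0 : f 0 = 0%N.
Hypothesis f_nd : forall s t, 0 <= s -> s <= t -> t <= T -> (f s <= f t)%N.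
Hypothesis f_cadlag : cadlag T (fun t => (f t)%:R : R).
Hypothesis f_jump : forall t, 0 <= t <= T ->
  jump (fun s => (f s)%:R : R) t = 0 \/ jump (fun s => (f s)%:R : R) t = 1.

Let above (m : nat) : set R := [set s | 0 <= s <= T /\ (m <= f s)%N].

(** For [m] between 1 and [f T], this is the time of the [m]-th jump. *)
Definition hitting_time (m : nat) : R := inf (above m).

(** Right continuity shows that level [m] is reached at the infimum itself, while the left limit
    there is at most [m - 1]. So the path jumps, and a jump of size 1 cannot pass [m]. *)
Lemma hitting_timeP m : (0 < m)%N -> (m <= f T)%N ->
  [/\ 0 < hitting_time m <= T, f (hitting_time m) = m,
      (forall s, 0 <= s -> s < hitting_time m -> (f s < m)%N)
    & jump (fun s => (f s)%:R : R) (hitting_time m) <> 0].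
Proof.
move=> m0 mT; set tau := hitting_time m.
have aT : above m T by split => //; rewrite lexx ltW.
have lb : lbound (above m) 0 by move=> s [/andP[]].
have hi : has_inf (above m) by split; [exists T|exists 0].
have tau0 : 0 <= tau by apply: lb_le_inf => //; exists T.
have tauT : tau <= T by apply: ge_inf => //; exists 0.
have before s : 0 <= s -> s < tau -> (f s < m)%N.
  move=> s0 st; rewrite ltnNge; apply/negP => ms.
  have : tau <= s.
    apply: ge_inf; first by exists 0.
    by split => //; rewrite s0 (le_trans (ltW st) tauT).
  by rewrite leNgt st.
have mtau : (m <= f tau)%N.
  have [tauTlt|] := ltP tau T; last first.
    by move=> Tle; have -> : tau = T by apply/eqP; rewrite eq_le tauT.
  have /cvgrPdist_lt/(_ 1 ltr01) := f_cadlag.1 tau ltac:(by rewrite tau0).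
  case=> e /= e0 H.
  (* A point of [above m] close to [tau] on the right has a value within 1 of [f tau]; both values
     being integers, [f tau] is at least [m] too. *)
  have [s [[/andP[s0 sT] ms] st]] : exists s, above m s /\ s < tau + e.
    have [s as_ se] := inf_adherent e0 hi; by exists s.
  have : tau <= s by apply: ge_inf; [exists 0|split => //; rewrite s0].
  rewrite le_eqVlt => /orP[/eqP ->//|ts].
  have := H s; rewrite /ball_/= ltr_distlC => /(_ _ ts).
  have -> : tau - e < s < tau + e by rewrite st andbT; lra.
  move=> /(_ isT); rewrite ltr_norml => /andP[h _].
  have : ((f s)%:R : R) < (f tau).+1%:R by rewrite -natr1; lra.
  by rewrite ltr_nat ltnS; apply: leq_trans.
(* Time 0 is excluded by [f 0 = 0]; [jump] is 0 there by convention, and a left limit is available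
   only at positive times. *)
have tau_gt0 : 0 < tau.
  rewrite lt_neqAle tau0 andbT; apply/negP => /eqP t0.
  by move: mtau; rewrite -t0 f0 leqNgt m0.
have cvl := f_cadlag.2 tau ltac:(by rewrite tau_gt0).
pose F s : R := (f s)%:R.
have jE : jump (fun s => (f s)%:R : R) tau =
    (f tau)%:R - lim (F x @[x --> tau^'-]).
  by rewrite /jump tau_gt0.
have lim_le : lim (F x @[x --> tau^'-]) <= m%:R - 1.
  apply: limr_le => //.
  near=> x.
  have x0 : 0 <= x by near: x; apply: nbhs_left_ge.
  have xt : x < tau by near: x; exact: nbhs_left_lt.
  by rewrite lerBrDr natr1 ler_nat; exact: before.
have mtauR : (m%:R : R) <= (f tau)%:R by rewrite ler_nat.
have jn0 : jump (fun s => (f s)%:R : R) tau <> 0 by rewrite jE => j0; lra.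
split => //; first by rewrite tau_gt0.
have tau01 : 0 <= tau <= T by rewrite tau0.
have [/jn0 []|j1] := f_jump tau01.
apply/eqP; rewrite eqn_leq mtau andbT -(ler_nat R).
by move: j1; rewrite jE; lra.
Unshelve. all: by end_near. Qed.

(** Successive hitting times up to level [f T] are distinct and finitely many, so their gaps have a
    positive minimum. An increase by two over [[s, t]] would place two successive hitting times in
    that interval. *)
Lemma counting_path_gap : exists2 e, 0 < e & forall s t, 0 <= s -> s <= t ->
  t <= T -> t - s <= e -> (f t <= (f s).+1)%N.
Proof.
pose g m := hitting_time m.+2 - hitting_time m.+1.
have [|e e0 eg] := @exists_pos_lower_bound _ g (f T).-1.
  move=> m mT.
  have m2 : (m.+2 <= f T)%N by move: mT; case: (f T).
  have [_ _ b2 _] := hitting_timeP (ltn0Sn m) (ltnW m2).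
  have [/andP[t2 _] f2 _ _] := hitting_timeP (ltn0Sn m.+1) m2.
  rewrite subr_gt0 ltNge; apply/negP; rewrite le_eqVlt => /orP[/eqP E|lt12].
    have [_ f1 _ _] := hitting_timeP (ltn0Sn m) (ltnW m2).
    by move: f2; rewrite E f1 => /eqP; rewrite eqn_leq ltnn andbF.
  by have := b2 _ (ltW t2) lt12; rewrite f2 ltnNge leqnSn.
(* Halving makes the contradiction strict: two hitting times in [[s, t]] would give
   [e <= t - s <= e / 2]. *)
exists (e / 2); first by rewrite divr_gt0.
move=> s t s0 st tT ts; rewrite leqNgt; apply/negP => fts.
have ftT : (f t <= f T)%N by apply: f_nd => //; exact: le_trans s0 st.
have m2 : ((f s).+2 <= f T)%N by exact: leq_trans fts ftT.
have [/andP[a1 _] f1 b1 _] := hitting_timeP (ltn0Sn (f s)) (ltnW m2).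
have [/andP[a2 _] f2 b2 _] := hitting_timeP (ltn0Sn (f s).+1) m2.
have st1 : s <= hitting_time (f s).+1.
  rewrite leNgt; apply/negP => lt; have := f_nd (ltW a1) (ltW lt) (le_trans st tT).
  by rewrite f1 ltnn.
have t2t : hitting_time (f s).+2 <= t.
  by rewrite leNgt; apply/negP => /(b2 _ (le_trans s0 st)); rewrite ltnNge fts.
have := eg (f s) ltac:(by move: m2; case: (f T)).
by rewrite /g; lra.
Qed.

End counting_path.

(** * Separation of the increments *)

(** The upper limit is an infimum of suprema over tails, so one of these suprema lies below
    [c + 1]. *)
Lemma limn_esup_lt (R : realType) (u : (\bar R)^nat) (c : R) :
  (limn_esup u <= c%:E)%E ->
  exists n0, forall n, (n0 <= n)%N -> (u n < (c + 1)%:E)%E.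
Proof.
move=> uc; have : (limn_esup u < (c + 1)%:E)%E.
  by apply: le_lt_trans uc _; rewrite lte_fin ltrDl.
rewrite /limn_esup limf_esupE => /ereal_inf_lt[_ [V [n0 _ n0V] <-] Vc].
exists n0 => n n0n; apply: le_lt_trans Vc.
by apply: ereal_sup_ubound; exists n => //; exact: n0V.
Qed.

Lemma sup_abs_integral_ge (R : realType) (f : R -> R) (h : R) (n i : nat) :
  (i < n)%N ->
  `|\int[lebesgue_measure]_(s in `[obs_time h i, obs_time h i.+1]) f s| <=
  sup_abs_integral f h n.
Proof.
move=> iN; rewrite /sup_abs_integral.
apply: (@le_bigmax_seq _ _ _ _ _ i.+1 xpredT
  (fun k => `|\int[lebesgue_measure]_(s in `[obs_time h k.-1, obs_time h k]) f s|)) => //.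
by rewrite mem_index_iota.
Qed.

(** Here [x] and [j] stand for increments of [X] and [J], and [g] for [h log (1/h)]. The difference
    [x - j] is at most [sqrt r] in size; since [e > 2 sqrt r], a jump of size at least [e] keeps [x]
    above [sqrt r]. *)
Lemma threshold_separation (R : realType) (x j g B r e : R) :
  0 <= g -> 0 <= B -> 0 < r -> 0 < e -> B ^+ 2 * g <= r -> r < e ^+ 2 / 4 ->
  `|x - j| <= B * Num.sqrt g ->
  (j = 0 -> x ^+ 2 <= r) /\ (e <= `|j| -> ~ x ^+ 2 <= r).
Proof.
move=> g0 B0 r0 e0 Bgr re xj.
have Bg : B * Num.sqrt g <= Num.sqrt r.
  rewrite -(ger0_norm B0) -sqrtr_sqr -sqrtrM ?sqr_ge0//.
  by rewrite ler_sqrt// ltW.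
have xjr := le_trans xj Bg.
have sr : Num.sqrt r ^+ 2 = r by rewrite sqr_sqrtr// ltW.
have xr : (x ^+ 2 <= r) = (`|x| <= Num.sqrt r).
  by rewrite -[X in _ <= X]sr -real_normK ?num_real// ler_sqr ?nnegrE ?sqrtr_ge0.
split=> [j0|ej]; rewrite xr.
  by move: xjr; rewrite j0 subr0.
move=> xlr; have : e / 2 <= Num.sqrt r.
  have : `|j| <= `|x| + `|x - j|.
    by rewrite -[X in `|X|](subKr x j); exact: ler_normB.
  by move=> h; move: h xlr xjr ej; move: `|j| `|x| `|_| => *; lra.
have e20 : 0 <= e / 2 by rewrite divr_ge0// ltW.
rewrite -ler_sqr ?nnegrE ?sqrtr_ge0// sr => h.
by move: (le_lt_trans h re); rewrite expr_div_n -natrX ltxx.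
Qed.

Lemma near_at_right0 (R : realType) (Q : R -> Prop) :
  (\forall h \near (0 : R)^'+, Q h) ->
  exists2 e, 0 < e & forall h, 0 < h -> h < e -> Q h.
Proof.
case=> e /= e0 H; exists e => // h h0 he; apply: H => //=.
by rewrite /ball_/= sub0r normrN gtr0_norm.
Qed.

(** Near 0 the ratio of [h * ln h^-1] to [r h] falls below the inverse of [B ^+ 2], and positivity
    of [r h] allows multiplying through. *)
Lemma threshold_near0 (R : realType) (r : R -> R) (B e : R) : 0 < B -> 0 < e ->
  (\forall h \near (0 : R)^'+, 0 < r h) ->
  r h @[h --> (0 : R)^'+] --> (0 : R) ->
  (h * ln (h^-1) / r h) @[h --> (0 : R)^'+] --> (0 : R) ->
  exists2 e', 0 < e' & forall h, 0 < h -> h < e' ->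
    [/\ 0 < r h, B ^+ 2 * (h * ln h^-1) <= r h & r h < e].
Proof.
move=> B0 e0 r_gt0 r_cvg0 r_dom; apply: near_at_right0.
have B2 : 0 < B ^+ 2 by rewrite exprn_gt0.
have B2V : 0 < (B ^+ 2)^-1 by rewrite invr_gt0.
move/cvgrPdist_lt/(_ _ e0) : r_cvg0 => n1.
move/cvgrPdist_lt/(_ _ B2V) : r_dom => n2.
near=> h.
have rh : 0 < r h by near: h.
split => //.
  have : `|0 - h * ln h^-1 / r h| < (B ^+ 2)^-1 by near: h.
  rewrite sub0r normrN => /(le_lt_trans (ler_norm _)).
  by rewrite ltr_pdivrMr// [X in _ < X]mulrC ltr_pdivlMr// [X in X < _]mulrC => /ltW.
have : `|0 - r h| < e by near: h.
by rewrite sub0r normrN gtr0_norm.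
Unshelve. all: by end_near. Qed.

Lemma Rintegral_increment (R : realType) (a : R -> R) (T s t : R) :
  (@lebesgue_measure R).-integrable `[0, T] (fun u => (a u)%:E) ->
  0 <= s -> s <= t -> t <= T ->
  \int[lebesgue_measure]_(u in `[0, t]) a u -
  \int[lebesgue_measure]_(u in `[0, s]) a u =
  \int[lebesgue_measure]_(u in `[s, t]) a u.
Proof.
move=> ia s0 st tT.
have iS (i : interval R) : [set` i] `<=` `[0, T] ->
    (@lebesgue_measure R).-integrable [set` i] (EFin \o a).
  by move=> iT; apply: integrableS ia.
rewrite Rintegral_itvB.
- rewrite Rintegral_itv_obnd_cbnd//; apply: iS => u /=; rewrite !in_itv/=.
  by move=> /andP[su ut]; rewrite (le_trans s0 (ltW su)) (le_trans ut tT).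
- apply: iS => u /=; rewrite !in_itv/= => /andP[u0 ut].
  by rewrite u0 (le_trans ut tT).
- by rewrite bnd_simp.
- by rewrite bnd_simp.
Qed.

(** On an interval shorter than the minimal gap, [J] changes by nothing or by a single [gam j] with
    [1 <= j <= f T]. These finitely many sizes are nonzero, as seen at the hitting time of each
    level [j]. *)
Lemma jump_separation (R : realType) (T : R) (f : R -> nat) (gam : nat -> R) :
  0 < T -> f 0 = 0%N ->
  (forall s t, 0 <= s -> s <= t -> t <= T -> (f s <= f t)%N) ->
  cadlag T (fun t => (f t)%:R : R) ->
  (forall t, 0 <= t <= T ->
    jump (fun s => (f s)%:R : R) t = 0 \/ jump (fun s => (f s)%:R : R) t = 1) ->
  (forall t, 0 <= t <= T ->
    ~ (jump (fun s => (f s)%:R : R) t <> 0 /\ gam (f t) = 0)) ->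
  let J t := \sum_(1 <= j < (f t).+1) gam j in
  exists e : R * R, [/\ 0 < e.1, 0 < e.2 & forall s t, 0 <= s -> s <= t ->
    t <= T -> t - s <= e.1 ->
    (f t = f s -> J t - J s = 0) /\ (f t <> f s -> e.2 <= `|J t - J s|)].
Proof.
move=> T0 f0 fnd fcad fjump gam0 J.
have [e e0 gap] := counting_path_gap T0 f0 fnd fcad fjump.
have [|c c0 cg] := @exists_pos_lower_bound _ (fun m => `|gam m.+1|) (f T).
  move=> m mT; rewrite normr_gt0; apply/eqP => g0.
  have [/andP[t0 tT] ft _ jt] := hitting_timeP T0 f0 fcad fjump (ltn0Sn m) mT.
  by apply: (gam0 (hitting_time T f m.+1)); rewrite ?(ltW t0)// ft.
exists (e, c); split => // s t s0 st tT ts; split=> [fts|/eqP fts].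
  by rewrite /J fts subrr.
have fst : f t = (f s).+1.
  apply/eqP; rewrite eqn_leq (gap _ _ s0 st tT ts)/=.
  by rewrite ltn_neqAle eq_sym fts fnd.
rewrite /J fst [X in _ <= `|X - _|]big_nat_recr//= addrAC subrr add0r.
by apply: cg; rewrite -fst; apply: fnd => //; exact: le_trans s0 st.
Qed.

Lemma indic_congr (R : realType) (U : Type) (A B : set U) (w : U) :
  (A w <-> B w) -> \1_A w = \1_B w :> R.
Proof.
move=> AB; rewrite !indicE; congr (nat_of_bool _)%:R.
by apply/idP/idP; rewrite !inE => /AB.
Qed.

Unset Implicit Arguments.

Theorem theorem3p1 (R : realType) (d : measure_display)
  (Omega : measurableType d) (P : probability Omega R)
  (T : R) (Ft : R -> set (set Omega))
  (W a sigma X : R -> Omega -> R) (x0 : R)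
  (N : R -> Omega -> nat) (gamma : nat -> {RV P >-> R})
  (C M : {RV P >-> R}) (r : R -> R)
  (T_gt0 : 0 < T)
  (filtrationF : filtration T Ft)
  (brownianW : brownian_motion P T Ft W)
  (progressive_a : progressively_measurable T Ft a)
  (progressive_sigma : progressively_measurable T Ft sigma)
  (countingN : counting_process P T N)
  (gamma_neq0 : no_null_jump P T N gamma)
  (solX : unique_strong_solution P T Ft W a sigma (jump_process N gamma) x0 X)
  (limsup_a : {ae P, forall w,
    (limn_esup (fun n => let h := (T / n%:R)%R in
       (sup_abs_integral (a ^~ w) h n / Num.sqrt (h * ln (h^-1)))%:E)
     <= (C w)%:E)%E})
  (int_sigma2 : {ae P, forall w,
    (\int[lebesgue_measure]_(s in `[0%R, T]) ((sigma s w) ^+ 2)%:E < +oo)%E})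
  (limsup_sigma : {ae P, forall w,
    (limn_esup (fun n => let h := (T / n%:R)%R in
       (sup_abs_integral (fun s => (sigma s w) ^+ 2) h n / h)%:E)
     <= (M w)%:E)%E})
  (r_gt0 : \forall h \near (0 : R)^'+, 0 < r h)
  (r_cvg0 : r h @[h --> (0 : R)^'+] --> (0 : R))
  (r_dom : (h * ln (h^-1) / r h) @[h --> (0 : R)^'+] --> (0 : R)) :
  {ae P, forall w, exists2 hbar : R, 0 < hbar &
    forall n : nat, (0 < n)%N -> let h := T / n%:R in h <= hbar ->
      forall i : nat, (1 <= i <= n)%N ->
        \1_[set w' | increment (fun t w => (N t w)%:R : R) h i w' = 0] w =
        \1_[set w' | (increment X h i w') ^+ 2 <= r h] w :> R}.
Proof.
have [[_ _ int_a [Y itoY eqX]] _] := solX.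
have modY := ito_modulus T_gt0 filtrationF brownianW progressive_sigma itoY.
have msig := progressively_measurable_joint (ltW T_gt0) filtrationF progressive_sigma.
have [_ pathN] := countingN.
near=> w.
have [N0 Nnd Ncad Njump] : [/\ N 0 w = 0%N,
    forall s t, 0 <= s -> s <= t -> t <= T -> (N s w <= N t w)%N,
    cadlag T (fun t => (N t w)%:R : R)
  & forall t, 0 <= t <= T ->
      jump (fun s => (N s w)%:R : R) t = 0 \/
      jump (fun s => (N s w)%:R : R) t = 1] by near: w.
have gam0 : forall t, 0 <= t <= T ->
    ~ (jump (fun s => (N s w)%:R : R) t <> 0 /\ gamma (N t w) w = 0) by near: w.
have aw : lebesgue_measure.-integrable `[0, T] (fun s => (a s w)%:E) by near: w.
have Xw : forall t, 0 <= t <= T ->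
    X t w = x0 + \int[lebesgue_measure]_(s in `[0, t]) a s w
            + Y t w + jump_process N gamma t w by near: w.
have modw : forall K : nat, exists n0 : nat,
    forall n i : nat, (n0 <= n)%N -> T < n%:R -> (i < n)%N ->
    let h := T / n%:R in
    (\int[lebesgue_measure]_(u in `[obs_time h i, obs_time h i.+1]) (sigma u w ^+ 2)%:E
       <= (K.+1%:R * h)%:E)%E ->
    `|Y (obs_time h i.+1) w - Y (obs_time h i) w| <
      Num.sqrt (96 * K.+1%:R * (h * ln h^-1)) by near: w.
have s2w : (\int[lebesgue_measure]_(s in `[0%R, T]) ((sigma s w) ^+ 2)%:E < +oo)%E
  by near: w.
have /limn_esup_lt[na naP] : (limn_esup (fun n => let h := (T / n%:R)%R in
    (sup_abs_integral (a ^~ w) h n / Num.sqrt (h * ln (h^-1)))%:E) <= (C w)%:E)%E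
  by near: w.
have /limn_esup_lt[ns nsP] : (limn_esup (fun n => let h := (T / n%:R)%R in
    (sup_abs_integral (fun s => (sigma s w) ^+ 2) h n / h)%:E) <= (M w)%:E)%E
  by near: w.
have [[e c] /= [e0 c0 sepJ]] :=
  jump_separation (gam := fun j => gamma j w) T_gt0 N0 Nnd Ncad Njump gam0.
(* An integer depending on [w] that dominates [M w + 1], the eventual bound on the normalized
   integrals of [sigma ^+ 2]. *)
pose K := Num.bound (`|M w| + 1).
have MK : M w + 1 <= K.+1%:R.
  have : `|M w| + 1 < K%:R by apply: archi_boundP; rewrite addr_ge0.
  by rewrite -natr1; have := ler_norm (M w); lra.
have [nY nYP] := modw K.
(* The drift contributes [|C w| + 1] and the Ito integral the square root, both in units of
   [sqrt (h log (1/h))]. *)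
pose B := `|C w| + 1 + Num.sqrt (96 * K.+1%:R).
have B0 : 0 < B by rewrite /B ltr_wpDr ?sqrtr_ge0// ltr_wpDl.
have c24 : 0 < c ^+ 2 / 4 by rewrite divr_gt0// exprn_gt0.
have [er er0 erP] := threshold_near0 B0 c24 r_gt0 r_cvg0 r_dom.
pose n1 := (maxn na (maxn ns nY)).+1.
have n10 : 0 < n1%:R :> R by rewrite ltr0n.
(* In order: the grid isolates the jumps; [h < er] strictly, for the threshold bounds; [n] is past
   all the random ranks; and [h < 1], so that [ln h^-1] is positive and [T < n]. *)
exists (Num.min (Num.min e (er / 2)) (Num.min (T / n1%:R) (2^-1))).
  by rewrite !lt_min e0 !divr_gt0//= invr_gt0.
move=> n n0; set h := T / n%:R => hle i /andP[i1 iN].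
have nR0 : 0 < n%:R :> R by rewrite ltr0n.
have h0 : 0 < h by rewrite /h divr_gt0.
move: hle; rewrite !le_min => /andP[/andP[he her] /andP[hn1 h12]].
have h1 : h < 1 by apply: le_lt_trans h12 _; rewrite invf_lt1// ltr1n.
have n1n : (n1 <= n)%N.
  move: hn1; rewrite /h ler_pM2l// lef_pV2 ?posrE// ler_nat //.
have Tn : T < n%:R by move: h1; rewrite /h ltr_pdivrMr// mul1r.
have l0 : 0 < ln h^-1 by rewrite ln_gt0// invf_gt1.
have g0 : 0 < h * ln h^-1 by rewrite mulr_gt0.
have [rh Bgr rc] : [/\ 0 < r h, B ^+ 2 * (h * ln h^-1) <= r h & r h < c ^+ 2 / 4].
  by apply: erP => //; move: her er0; lra.
case: i i1 iN => // i _ iN.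
have /andP[s0 sT] := obs_time_lag T_gt0 n0 (ltnW iN).
have /andP[t0 tT] := obs_time_lag T_gt0 n0 iN.
rewrite -/h in s0 sT t0 tT.
have ts : obs_time h i.+1 - obs_time h i = h.
  by rewrite /obs_time -mulrBl -natrB// subSnn mul1r.
have st : obs_time h i <= obs_time h i.+1 by rewrite -subr_ge0 ts ltW.
have [sep0 sep1] := sepJ _ _ s0 st tT ltac:(by rewrite ts).
have sg0 : 0 < Num.sqrt (h * ln h^-1) by rewrite sqrtr_gt0.
have ia : `|\int[lebesgue_measure]_(u in `[obs_time h i, obs_time h i.+1]) a u w|
    <= (`|C w| + 1) * Num.sqrt (h * ln h^-1).
  apply: le_trans (sup_abs_integral_ge (a ^~ w) h iN) _.
  have := naP n (leq_trans _ n1n); rewrite lte_fin ltr_pdivrMr// => na'.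
  apply: le_trans (ltW (na' _)) _.
    by rewrite /n1 ltnW// ltnS leq_maxl.
  by rewrite ler_wpM2r ?(ltW sg0)// lerD2r ler_norm.
have is2 : (\int[lebesgue_measure]_(u in `[obs_time h i, obs_time h i.+1])
    (sigma u w ^+ 2)%:E <= (K.+1%:R * h)%:E)%E.
  set I := (\int[lebesgue_measure]_(u in _) _)%E.
  have I0 : (0 <= I)%E by apply: integral_ge0 => u _; rewrite lee_fin sqr_ge0.
  (* [sup_abs_integral] uses real-valued integrals, which send an infinite value to 0; finiteness is
     what transfers its bound to the extended integral [I]. *)
  have Ify : (I < +oo)%E.
    apply: le_lt_trans s2w; apply: ge0_subset_integral => //.
    - apply/measurable_EFinP/measurable_funX.
      exact: (jointly_measurable_section w _ msig).
    - by move=> u _; rewrite lee_fin sqr_ge0.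
    - move=> u /=; rewrite !in_itv/= => /andP[su ut].
      by rewrite (le_trans s0 su) (le_trans ut tT).
  have If : I \is a fin_num by rewrite ge0_fin_numE.
  rewrite -(fineK If) lee_fin.
  apply: le_trans (ler_norm _) _.
  apply: le_trans (sup_abs_integral_ge (fun u => sigma u w ^+ 2) h iN) _.
  have := nsP n (leq_trans _ n1n); rewrite lte_fin ltr_pdivrMr// => ns'.
  apply: le_trans (ltW (ns' _)) _.
    by rewrite /n1 ltnW// ltnS leq_max leq_max leqnn orbT.
  by rewrite ler_wpM2r// ltW.
have dY : `|Y (obs_time h i.+1) w - Y (obs_time h i) w| <=
    Num.sqrt (96 * K.+1%:R) * Num.sqrt (h * ln h^-1).
  rewrite -sqrtrM ?mulr_ge0//; apply/ltW/nYP => //.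
  by apply: leq_trans n1n; rewrite /n1 ltnW// ltnS leq_max leq_max leqnn !orbT.
(* Subtracting the jump part cancels [x0] and leaves the drift and Ito increments, bounded by [ia]
   and [dY]. *)
have dX : `|increment X h i.+1 w - (jump_process N gamma (obs_time h i.+1) w -
     jump_process N gamma (obs_time h i) w)| <= B * Num.sqrt (h * ln h^-1).
  rewrite /increment/= Xw ?t0// Xw ?s0//.
  rewrite -(Rintegral_increment aw s0 st tT) in ia.
  set A1 := \int[_]_(_ in _) _ in ia *; set A2 := \int[_]_(_ in _) _ in ia *.
  set Y1 := Y _ w in dY *; set Y2 := Y _ w in dY *.
  rewrite (_ : _ - _ = (A1 - A2) + (Y1 - Y2)); last by ring.
  apply: le_trans (ler_normD _ _) _.
  by rewrite /B mulrDl; exact: lerD.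
have [jX0 jX1] := threshold_separation (ltW g0) (ltW B0) rh c0 Bgr rc dX.
apply: indic_congr; split => /=.
  rewrite /increment/= => /eqP; rewrite subr_eq0 eqr_nat => /eqP Nts.
  by apply: jX0; exact: sep0.
move=> Xr; rewrite /increment/=; apply/eqP; rewrite subr_eq0 eqr_nat.
by apply/negP => /negP/eqP Nts; apply: jX1 Xr; exact: sep1.
Unshelve. all: by end_near. Qed.
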